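(* Let $\mathbb{T}$ be a time scale, $t_0\in\mathbb{T}$, $x_0\in\mathbb{R}$, $a,b>0$, and let $f(t,x)$ be a real-valued function that is rd-continuous on $B_0=\{(t,x): t\in[t_0,t_0+a]\cap\mathbb{T},\ |x-x_0|\le b\}$. Let $M=\max_{B_0}|f(t,x)|$ and $h=\min\{a,\frac{b}{M}\}$. Then for every $\epsilon>0$ there exists an $\epsilon$-approximate solution of $$x^{\Delta}(t)=f(t,x(t)),\qquad x(t_0)=x_0,$$ on $[t_0,t_0+h]\cap\mathbb{T}$.
   Context: A time scale $\mathbb{T}$ is a nonempty closed subset of $\mathbb{R}$. The forward jump operator is $\sigma(t)=\inf\{s\in\mathbb{T}:s>t\}$, the backward jump operator is $\rho(t)=\sup\{s\in\mathbb{T}:s<t\}$. A point $t$ is right-dense if $t<\sup\mathbb{T}$ and $\sigma(t)=t$, and left-dense if $t>\inf\mathbb{T}$ and $\rho(t)=t$. A function $g:\mathbb{T}\to\mathbb{R}$ is rd-continuous if it is continuous at right-dense points and its left-sided limit exists at left-dense points. A function $f(t,x)$ of two variables is called rd-continuous (standard time-scale convention) if $t\mapsto f(t,x(t))$ is rd-continuous for every continuous function $x$ whose graph lies in the domain. The delta derivative $g^{\Delta}(t)$ is the number such that for each $\epsilon>0$ there is a neighbourhood $U$ of $t$ with $|g(\sigma(t))-g(s)-g^{\Delta}(t)(\sigma(t)-s)|\le\epsilon|\sigma(t)-s|$ for all $s\in U$ (in $\mathbb{T}$). $C^1_{rd}$ denotes the delta differentiable functions whose delta derivative is rd-continuous.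 A function $x(t)$ is called an $\epsilon$-approximate solution of $x^{\Delta}(t)=f(t,x(t))$ on a time scale interval $I=[t_0,t_0+h]\cap\mathbb{T}$, relative to a compact set $\Omega$ of points $(t,x)$ (here $\Omega=B_0$), if: (i) $(t,x(t))\in\Omega$ for all $t\in I$; (ii) $x\in C^1_{rd}$ on $I$ except possibly on a finite set $S$ (or a set $S$ of measure zero), where $x^{\Delta}$ may have simple discontinuities; (iii) $|x^{\Delta}(t)-f(t,x(t))|\le\epsilon$ for each $t\in I\setminus S$. *)

(* Defs.v *)
From mathcomp Require Import all_boot all_order all_algebra.
From mathcomp Require Import all_classical all_reals all_analysis.
Set Implicit Arguments.
Unset Strict Implicit.
Unset Printing Implicit Defensive.
Import Order.TTheory GRing.Theory Num.Theory.
Import numFieldNormedType.Exports.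
Local Open Scope classical_set_scope.
Local Open Scope ring_scope.

(* A function on a time scale T is represented by a total function R -> R;
   every notion below only looks at its values on T. *)

Section TimeScales.
Context {R : realType}.
Implicit Types (T I S : set R) (g x : R -> R) (f : R -> R -> R) (t d : R).

Definition time_scale T : Prop := T !=set0 /\ closed T.

(* The tests for emptiness implement the usual conventions
   inf set0 = sup T and sup set0 = inf T (in the library inf set0 = 0). *)
Definition forward_jump T t : R :=
  if [set s | T s /\ t < s] == set0 then sup T else inf [set s | T s /\ t < s].

Definition backward_jump T t : R :=
  if [set s | T s /\ s < t] == set0 then inf T else sup [set s | T s /\ s < t].

(* The bounds of T are taken in \bar R since T may be unbounded. *)
Definition right_dense T t : Prop :=
  [/\ T t, (t%:E < ereal_sup (EFin @` T))%E & forward_jump T t = t].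

Definition left_dense T t : Prop :=
  [/\ T t, (ereal_inf (EFin @` T) < t%:E)%E & backward_jump T t = t].

Definition has_left_limit (D : set R) g t : Prop :=
  exists l : R, g s @[s --> within (D `&` [set s | s < t]) (nbhs t)] --> l.

Definition has_right_limit (D : set R) g t : Prop :=
  exists l : R, g s @[s --> within (D `&` [set s | t < s]) (nbhs t)] --> l.

(* Here g is only considered on T `\` S; right- and left-density refer to T. *)
Definition rd_continuous_off T S g : Prop :=
  (forall t, right_dense T t -> ~ S t ->
     g s @[s --> within (T `\` S) (nbhs t)] --> g t) /\
  (forall t, left_dense T t -> ~ S t -> has_left_limit (T `\` S) g t).

Definition rd_continuous T g : Prop := rd_continuous_off T set0 g.

Definition rd_continuous2 T (B : set (R * R)) f : Prop :=
  forall x, {within T, continuous x} -> (forall t, T t -> B (t, x t)) ->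
    rd_continuous T (fun t => f t (x t)).

Definition delta_derivative T g t d : Prop :=
  forall e : R, 0 < e -> \forall s \near nbhs t, T s ->
    `|g (forward_jump T t) - g s - d * (forward_jump T t - s)|
      <= e * `|forward_jump T t - s|.

(* The time scale interval I is regarded as a time scale in its own right, so
   that the notion depends on x only through its values on I.  The exceptional
   set S contains no right-scattered points: those have positive Delta-measure,
   and exempting them would make the definition void on a discrete interval.
   At points of S only x^Delta may be discontinuous, not x. *)
Definition approximate_solution I (Omega : set (R * R)) f (eps : R) x : Prop :=
  [/\ forall t, I t -> Omega (t, x t),
      {within I, continuous x} &
      exists (S : set R) (xD : R -> R),
        [/\ finite_set S,
            (forall t, S t -> I t /\ forward_jump I t = t),
            (forall t, (I `\` S) t -> delta_derivative I x t (xD t)),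
            rd_continuous_off I S xD /\
            (forall t, S t ->
               (left_dense I t -> has_left_limit (I `\` S) xD t) /\
               (right_dense I t -> has_right_limit (I `\` S) xD t)) &
            (forall t, (I `\` S) t -> `|xD t - f t (x t)| <= eps)]].

Definition ts_interval T (t0 c : R) : set R := T `&` `[t0, t0 + c].

Definition box T (t0 x0 a b : R) : set (R * R) :=
  [set p | ts_interval T t0 a p.1 /\ `|p.2 - x0| <= b].

Definition is_max (A : set R) (M : R) : Prop := A M /\ ubound A M.

(* min {a, b / M} with the convention b / 0 = +oo (in the library b / 0 = 0). *)
Definition step_length (a b M : R) : R :=
  if M == 0 then a else Num.min a (b / M).

End TimeScales.

(* Main.v *)
(* Euler polygons on a time scale.  Testing rd-continuity along continuous
   curves through suitably interlaced points shows that f is jointly continuous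
   from the right at right-dense points and has joint left limits at left-dense
   points, the latter with a modulus that is uniform in x by compactness of
   [x0 - b, x0 + b].  Hence a curve that is M-Lipschitz and piecewise linear with
   residual at most eps can be prolonged by one linear piece across a gap, to the
   right of a right-dense point, and, by uniformity, up to a left-dense point from
   any sufficiently close earlier one.  So the supremum of the endpoints reached by
   finitely many pieces is reached, and it is the maximum of the interval.  The
   exceptional set consists of the breakpoints that are not right-scattered. *)
Require Import Defs.
From mathcomp Require Import all_boot all_order all_algebra.
From mathcomp Require Import all_classical all_reals all_analysis.
From mathcomp Require Import ring lra zify.
Import Order.TTheory GRing.Theory Num.Theory.
Import numFieldNormedType.Exports.
Local Open Scope classical_set_scope.
Local Open Scope ring_scope.

(** * Interpolating curves and joint limits *)

(** Lets a neighbourhood discard any initial segment of a sequence, leaving only the tail, which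
    convergence controls. *)
Lemma near_avoid_finite (R : realType) (s : nat -> R) (N : nat) (p : R) :
  \forall q \near p, forall n, (n < N)%N -> s n = q -> q = p.
Proof.
elim: N => [|N IH]; first by near=> q.
have HN : \forall q \near p, s N = q -> q = p.
  have [->|sp] := eqVneq (s N) p; first by near=> q => ->.
  have : \forall q \near p, q != s N.
    by apply: open_nbhs_nbhs; split; [exact: open_neq | rewrite /= eq_sym].
  by apply: filterS => q /eqP qs sq; case: qs.
near=> q => n; rewrite ltnS leq_eqVlt => /orP[/eqP ->|nN].
  by near: q.
by move: n nN; near: q.
Unshelve. all: by end_near. Qed.

(** The points [s n] and [t] form a closed set in which only [t] can fail to be isolated. The
    prescribed values are continuous on it because [z] tends to [y], and Tietze's theorem extends
    them with the same bound. *)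
Lemma continuous_interpolation (R : realType) (s z : nat -> R) (t x0 b y : R) :
  0 < b -> injective s -> (forall n, s n <> t) -> s @ \oo --> t ->
  (forall n, `|z n - x0| <= b) -> `|y - x0| <= b -> z @ \oo --> y ->
  exists x : R -> R, [/\ continuous x, forall u, `|x u - x0| <= b,
    x t = y & forall n, x (s n) = z n].
Proof.
move=> b0 sinj snt st zb yb zy.
pose A := [set t] `|` range s.
have isolated p : p != t -> \forall q \near p, A q -> q = p.
  move=> pt; have r0 : 0 < `|p - t| / 2 by rewrite divr_gt0// normr_gt0 subr_eq0.
  move/cvgrPdist_lt : st => /(_ _ r0)[N _ HN].
  have near_p := near_avoid_finite R s N p.
  near=> q => Aq.
  have pq : `|p - q| < `|p - t| / 2 by near: q; exact: nbhsx_ballx.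
  have qt : `|p - t| / 2 < `|t - q|.
    by have := ler_distD q p t; rewrite (distrC q t); lra.
  have [qe|[n _ snq]] := Aq; first by move: qt; rewrite qe subrr normr0; lra.
  have nN : (n < N)%N.
    by rewrite ltnNge; apply/negP => /HN /=; rewrite snq; lra.
  by move: n nN snq {Aq}; near: q.
have clA : closed A.
  move=> p clp; have [->|pt] := eqVneq p t; first by left.
  by have [q [Aq /(_ Aq) <-]] := clp _ (isolated _ pt).
pose w u := if pselect (exists n, s n = u) is left P then z (projT1 (cid P)) else y.
have ws n : w (s n) = z n.
  rewrite /w; case: pselect => [P|[]]; last by exists n.
  by congr z; apply: sinj; case: (cid P).
have wt : w t = y.
  by rewrite /w; case: pselect => // P; have [n tn] := P; case: (snt n tn).
(* Extending [w - x0] instead of [w] turns the bound on [g] into a bound on the distance to [x0]. *)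
have [g [gA gc gb]] : exists g : R -> R^o, [/\ {in A, (fun u => w u - x0) =1 g},
    continuous g & forall u, `|g u| <= b].
  apply: continuous_bounded_extension => //.
  - exact: (@pseudometric_normal R).
  - apply/subspace_continuousP => p Ap.
    apply: (@cvgB _ R^o) => //; last exact: cvg_cst.
    apply/cvgrPdist_lt => e e0.
    have [->|pt] := eqVneq p t; last first.
      rewrite near_withinE; apply: filterS (isolated _ pt) => q Hq /Hq ->.
      by rewrite subrr normr0.
    rewrite near_withinE wt.
    move/cvgrPdist_lt : zy => /(_ _ e0)[N _ HN].
    apply: filterS (near_avoid_finite R s N t) => q Hq [->|[n _ snq]].
      by rewrite wt subrr normr0.
    rewrite -snq ws; apply: HN => /=; rewrite leqNgt; apply/negP => nN.
    by apply: (snt n); rewrite snq; exact: Hq snq.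
  - by move=> _ [->|[n _ <-]]; rewrite ?wt// ws.
exists (fun u => x0 + g u); split.
- by move=> u; apply: cvgD; [exact: cvg_cst | exact: gc].
- by move=> u; rewrite addrC addKr.
- by rewrite -gA ?wt; [rewrite addrC subrK | rewrite inE; left].
- by move=> n; rewrite -gA ?ws; [rewrite addrC subrK | rewrite inE; right; exists n].
Unshelve. all: by end_near. Qed.

(* If the conclusion fails, there are u_n --> t and y_n --> y in D with
   |f u_n y_n - L| > e; a continuous x through the points (u_n, y_n) for n even
   and (u_n, y) for n odd then contradicts the existence of the limit of
   f u (x u). *)
Lemma joint_limit (R : realType) (D : set R) (f : R -> R -> R) (t x0 b y L : R) :
  0 < b -> ~ D t -> `|y - x0| <= b ->
  (forall x : R -> R, continuous x -> (forall u, `|x u - x0| <= b) ->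
     x t = y -> exists l : R, f u (x u) @[u --> within D (nbhs t)] --> l) ->
  f u y @[u --> within D (nbhs t)] --> L ->
  forall e : R, 0 < e -> exists2 d : R, 0 < d & forall u y', D u -> `|u - t| < d ->
    `|y' - y| < d -> `|y' - x0| <= b -> `|f u y' - L| <= e.
Proof.
move=> b0 Dt yb fx fL e e0; apply: contrapT => nd.
have bad (d : R) : exists p : R * R, 0 < d ->
    [/\ D p.1, `|p.1 - t| < d, `|p.2 - y| < d, `|p.2 - x0| <= b &
        e < `|f p.1 p.2 - L|].
  apply: contrapT => nb; have [d0|d0] := ltP 0 d; last first.
    by apply: nb; exists (t, t); rewrite ltNge d0.
  apply: nd; exists d => // u y' Du ud yd y'b; rewrite leNgt; apply/negP => fe.
  by apply: nb; exists (u, y').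
have [q Hq] := choice bad.
(* Each radius is half the distance from [t] to the previous bad point. So the distances of the
   [s n] to [t] strictly decrease, which makes [s] injective, and [del] more than halves at each
   step. *)
pose del := fix del n : R := if n is m.+1 then `|(q (del m)).1 - t| / 2 else 1.
pose s n := (q (del n)).1.
have del0 n : 0 < del n.
  elim: n => [|n IH] /=; first exact: ltr01.
  have [Ds _ _ _ _] := Hq _ IH; rewrite divr_gt0// normr_gt0 subr_eq0.
  by apply/eqP => st; rewrite st in Ds.
have Hs n := Hq _ (del0 n).
have delS n : del n.+1 < del n / 2.
  by rewrite /= ltr_pM2r ?invr_gt0//; case: (Hs n).
have del_lt n m : (n < m)%N -> del m < del n.
  apply: (homo_ltn (r := fun a c => c < a)) => [a c d ca da|k].
    exact: lt_trans da ca.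
  by have := delS k; have := del0 k; lra.
have del_cvg : del @ \oo --> 0.
  apply: (@squeeze_cvgr _ _ _ _ (fun=> 0) (fun n => n.+1%:R^-1)).
  - near=> n; rewrite (ltW (del0 n))/=.
    elim: (n) => [|k IH]; first by rewrite /= invr1.
    apply: (le_trans (ltW (delS k))); apply: (le_trans (y := k.+1%:R^-1 / 2)).
      by rewrite ler_pM2r ?invr_gt0.
    rewrite -invfM lef_pV2 ?posrE ?mulr_gt0 ?ltr0n//.
    by rewrite -natrM ler_nat; lia.
  - exact: cvg_cst.
  - exact: cvg_harmonic.
have cvg_del (v : nat -> R) l : (forall n, `|v n - l| < del n) -> v @ \oo --> l.
  move=> vl; apply/cvgrPdist_lt => eta eta0.
  move/cvgrPdist_lt : del_cvg => /(_ _ eta0); apply: filterS => n.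
  rewrite sub0r normrN gtr0_norm// => dn.
  by rewrite distrC; exact: lt_trans (vl n) dn.
have s_cvg : s @ \oo --> t by apply: cvg_del => n; case: (Hs n).
have s_lt n m : (n < m)%N -> `|s m - t| < `|s n - t|.
  move=> nm; have [_ sm _ _ _] := Hs m; apply: (lt_le_trans sm).
  have : del m <= del n.+1.
    by move: nm; rewrite leq_eqVlt => /orP[/eqP<-|/del_lt/ltW].
  by rewrite /= -/(s n) => /le_trans; apply; rewrite ler_pdivrMr// ler_peMr// ler1n.
have s_inj : injective s.
  by move=> n m snm; case: (ltngtP n m) => // /s_lt; rewrite snm ltxx.
pose z n := if odd n then y else (q (del n)).2.
have [x [xc xb xt xs]] : exists x : R -> R, [/\ continuous x,
    forall u, `|x u - x0| <= b, x t = y & forall n, x (s n) = z n].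
  apply: continuous_interpolation => //.
  - by move=> n st; have [Ds _ _ _ _] := Hs n; apply: Dt; rewrite -st.
  - by move=> n; rewrite /z; case: odd => //; case: (Hs n).
  - apply: cvg_del => n; rewrite /z; case: odd; last by case: (Hs n).
    by rewrite subrr normr0.
have [l fl] := fx _ xc xb xt.
have sF : s @ \oo --> within D (nbhs t).
  move=> P /s_cvg HP.
  have : \forall n \near \oo, D (s n) -> P (s n) by exact: HP.
  by apply: filterS => n; apply; case: (Hs n).
have e4 : 0 < e / 4 by rewrite divr_gt0.
have /cvgrPdist_lt/(_ _ e4)[N1 _ H1] := cvg_comp _ _ sF fl.
have /cvgrPdist_lt/(_ _ e4)[N2 _ H2] := cvg_comp _ _ sF fL.
(* At index [2N] the curve meets a bad point, at [2N+1] the value [y]. Three errors below [e / 4]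
   then link the bad value to [L], although it is more than [e] away. *)
pose N := (N1 + N2)%N.
have /H1/= : (N1 <= N.*2)%N by rewrite /N; lia.
have /H1/= : (N1 <= N.*2.+1)%N by rewrite /N; lia.
have /H2/= : (N2 <= N.*2.+1)%N. by rewrite /N; lia.
rewrite !xs /z /= !odd_double /=.
have [_ _ _ _] := Hs (N.*2); rewrite -/(s _).
set A := f _ _; set B := f _ _ => eA LB lB lA.
have := ler_distD l A L; have := ler_distD B l L.
by rewrite (distrC A l) (distrC B L); lra.
Unshelve. all: by end_near. Qed.

(** * One-sided limits of an rd-continuous field *)

Section RdContinuousField.
Variables (R : realType) (T : set R) (t0 x0 a b : R) (f : R -> R -> R).
Let J := ts_interval T t0 a.
Hypotheses (b0 : 0 < b) (rd_f : rd_continuous2 J (box T t0 x0 a b) f).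

Let rd_along (x : R -> R) : continuous x -> (forall u, `|x u - x0| <= b) ->
  rd_continuous J (fun t => f t (x t)).
Proof.
move=> xc xb; apply: rd_f => [|t Jt]; last by split; [exact: Jt | exact: xb].
exact: continuous_subspaceT.
Qed.

Lemma right_dense_joint_limit (t y e : R) :
  right_dense J t -> `|y - x0| <= b -> 0 < e ->
  exists2 d : R, 0 < d & forall u y', J u -> t < u -> u < t + d ->
    `|y' - y| < d -> `|y' - x0| <= b -> `|f u y' - f t y| <= e.
Proof.
move=> rdt yb e0; pose D := J `&` [set u | t < u].
have along x : continuous x -> (forall u, `|x u - x0| <= b) -> x t = y ->
    f u (x u) @[u --> within D (nbhs t)] --> f t y.
  move=> xc xb <-; apply: cvg_trans ((rd_along _ xc xb).1 _ rdt id).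
  by apply: cvg_app; apply: within_subset => u [Ju _]; split.
have Dt : ~ D t by case=> _; rewrite /= ltxx.
have fD : f u y @[u --> within D (nbhs t)] --> f t y.
  by apply: (along (fun=> y)) => //; exact: cst_continuous.
have [|d d0 Hd] := @joint_limit R D f t x0 b y (f t y) b0 Dt yb _ fD _ e0.
  by move=> x xc xb xt; exists (f t y); exact: along.
exists d => // u y' Ju tu ud; apply: Hd => //.
by rewrite gtr0_norm ?subr_gt0// ltrBlDl.
Qed.

(** The constant curve [y] supplies the limit [L]. It need not equal [f t y], as rd-continuity only
    asks for existence on this side. *)
Lemma left_dense_joint_limit (t y e : R) :
  left_dense J t -> `|y - x0| <= b -> 0 < e ->
  exists2 d : R, 0 < d & exists L, forall u y', J u -> u < t -> t - d < u ->
    `|y' - y| < d -> `|y' - x0| <= b -> `|f u y' - L| <= e.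
Proof.
move=> ldt yb e0; pose D := J `&` [set u | u < t].
have along x : continuous x -> (forall u, `|x u - x0| <= b) ->
    exists L : R, f u (x u) @[u --> within D (nbhs t)] --> L.
  move=> xc xb; have [L fL] := (rd_along _ xc xb).2 _ ldt id.
  exists L; apply: cvg_trans fL.
  by apply: cvg_app; apply: within_subset => u [Ju tu]; split => //; split.
have [|//|L fL] := along (fun=> y); first exact: cst_continuous.
have Dt : ~ D t by case=> _; rewrite /= ltxx.
have [|d d0 Hd] := @joint_limit R D f t x0 b y L b0 Dt yb _ fL _ e0.
  by move=> x xc xb xt; exact: along.
exists d => //; exists L => u y' Ju tu ud; apply: Hd => //.
by rewrite distrC gtr0_norm ?subr_gt0// ltrBlDl -ltrBlDr.
Qed.

(** Comparing two values of [f] eliminates the unknown limit [L], which depends on [y]; compactness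
    then gives one [d] for all [y]. *)
Lemma left_dense_uniform (t e : R) : left_dense J t -> 0 < e ->
  exists2 d : R, 0 < d & forall u u' y y', J u -> J u' -> u < t -> u' < t ->
    t - d < u -> t - d < u' -> `|y - x0| <= b -> `|y' - x0| <= b ->
    `|y' - y| < d -> `|f u y - f u' y'| <= e.
Proof.
move=> ldt e0.
have /compact_near_coveringP cov : compact `[x0 - b, x0 + b] := @segment_compact _ _ _.
pose P (d y : R) := forall u u' y', J u -> J u' -> u < t -> u' < t ->
    t - d < u -> t - d < u' -> `|y - x0| <= b -> `|y' - x0| <= b ->
    `|y' - y| < d -> `|f u y - f u' y'| <= e.
have mem_box y : `[x0 - b, x0 + b]%classic y <-> `|y - x0| <= b.
  by rewrite /= in_itv/= ler_distl.
have : \forall d \near 0^'+, `[x0 - b, x0 + b]%classic `<=` P d.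
  apply: cov => y0 /mem_box y0b.
  have e2 : 0 < e / 2 by rewrite divr_gt0.
  have [r r0 [L HL]] := left_dense_joint_limit t y0 _ ldt y0b e2.
  have r2 : 0 < r / 2 by rewrite divr_gt0.
  (* Since [y] is within [r / 2] of [y0] and [d < r / 2], both [y] and [y'] are within [r] of [y0],
     so both values are within [e / 2] of the same [L]. *)
  have close (y d : R) : `|y - y0| < r / 2 -> d < r / 2 -> P d y.
    move=> yy0 dr u u' y' Ju Ju' ut u't du du' yb y'b y'y.
    have fL : `|f u y - L| <= e / 2 by apply: HL => //; lra.
    have fL' : `|f u' y' - L| <= e / 2.
      by apply: HL => //; [lra | have := ler_distD y y' y0; lra].
    by have := ler_distD L (f u y) (f u' y'); rewrite (distrC L); lra.
  exists (ball y0 (r / 2), [set d : R | d < r / 2]).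
    by split; [exact: nbhsx_ballx | exact: nbhs_right_lt].
  by move=> [y d] [/= yy0 dr]; apply: close => //; rewrite distrC.
move=> H; near (0 : R)^'+ => d.
exists d => // u u' y y' Ju Ju' ut u't du du' yb.
have : P d y by (have : `[x0 - b, x0 + b]%classic `<=` P d by near: d); apply; apply/mem_box.
exact.
Unshelve. all: by end_near. Qed.

End RdContinuousField.

(** * Euler polygons and their prolongation *)

(* [x] is piecewise linear on [[t0, c]], with slope [xD s] immediately to the
   right of [s]; the slope can only jump at the breakpoints in [P]. *)
Record euler_polygon (R : realType) (T : set R) (f : R -> R -> R)
    (t0 x0 M eps c : R) (x xD : R -> R) (P : seq R) : Prop := EulerPolygon {
  polygon_init : x t0 = x0;
  polygon_lipschitz : forall u v, `|x u - x v| <= M * `|u - v|;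
  polygon_residual : forall t, T t -> t0 <= t -> t < c ->
    `|xD t - f t (x t)| <= eps;
  polygon_right : forall t, t0 <= t -> t < c -> exists u, [/\ T u, t < u, u <= c,
    forall s, t <= s -> s <= u -> x s = x t + xD t * (s - t) &
    forall s, t <= s -> s < u -> xD s = xD t];
  polygon_left : forall t, t0 < t -> t <= c -> exists v m, [/\ v < t,
    forall s, v <= s -> s < t -> x s = x t + m * (s - t),
    forall s, v <= s -> s < t -> xD s = m &
    t < c -> t \notin P -> xD t = m];
  polygon_start : t0 \in P }.

Lemma euler_polygon_start (R : realType) (T : set R) (f : R -> R -> R)
    (t0 x0 M eps : R) : 0 <= M ->
  euler_polygon R T f t0 x0 M eps t0 (fun=> x0) (fun=> 0) [:: t0].
Proof.
move=> M0; split => //.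
- by move=> u v; rewrite subrr normr0 mulr_ge0.
- by move=> t _ ? ?; lra.
- by move=> t ? ?; lra.
- by move=> t ? ?; lra.
- by rewrite inE.
Qed.

(** Glues a linear piece of slope [m] at [c], which becomes a breakpoint. The residual is only
    tested at points of [T] in [[c, u)], so a piece across a gap is tested at [c] alone. *)
Lemma euler_polygon_extend (R : realType) (T : set R) (f : R -> R -> R)
    (t0 x0 M eps c u m : R) (x xD : R -> R) (P : seq R) :
  euler_polygon R T f t0 x0 M eps c x xD P -> t0 <= c -> T u -> c < u ->
  `|m| <= M ->
  (forall t, T t -> c <= t -> t < u -> `|m - f t (x c + m * (t - c))| <= eps) ->
  exists y yD Q, euler_polygon R T f t0 x0 M eps u y yD Q.
Proof.
move=> [xt0 xlip xres xright xleft Pt0] tc Tu cu mM mres.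
pose y s := if s <= c then x s else x c + m * (s - c).
(* The comparison is strict here, unlike in [y]: at [c] the slope is already the new one. *)
pose yD s := if s < c then xD s else m.
have yl s : s <= c -> y s = x s by rewrite /y => ->.
have yr s : c <= s -> y s = x c + m * (s - c).
  rewrite /y le_eqVlt => /orP[/eqP <-|]; first by rewrite lexx subrr mulr0 addr0.
  by rewrite ltNge => /negbTE ->.
have yDl s : s < c -> yD s = xD s by rewrite /yD => ->.
have yDr s : c <= s -> yD s = m by rewrite /yD leNgt => /negbTE ->.
exists y, yD, (c :: P); split.
- by rewrite yl.
- have lip v w : v <= w -> `|y v - y w| <= M * `|v - w|.
    move=> vw; have [wc|cw] := leP w c.
      by rewrite !yl// (le_trans vw).
    rewrite (yr w (ltW cw)); have [cv|vc] := leP c v.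
      rewrite (yr v cv) opprD addrACA subrr add0r -mulrBr.
      have -> : v - c - (w - c) = v - w by ring.
      by rewrite normrM ler_wpM2r.
    rewrite (yl _ (ltW vc)).
    have -> : x v - (x c + m * (w - c)) = (x v - x c) - m * (w - c) by ring.
    apply: (le_trans (ler_normB _ _)).
    have -> : `|v - w| = `|v - c| + `|w - c|.
      by rewrite (distrC v w) (distrC v c) !gtr0_norm ?subr_gt0//; lra.
    by rewrite [leRHS]mulrDr lerD// normrM ler_wpM2r.
  move=> v w; have [/lip//|/ltW/lip] := leP v w.
  by rewrite distrC (distrC w).
- move=> t Tt t0t tu; have [ct|tc'] := leP c t; last first.
    by rewrite yDl// (yl _ (ltW tc')) xres.
  by rewrite yDr// yr// mres.
- move=> t t0t tu; have [ct|tc'] := leP c t.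
    exists u; split => // s ts su; last by rewrite !yDr// (le_trans ct).
    by rewrite yDr// !yr//; [ring | exact: le_trans ct ts].
  have [w [Tw tw wc xw xDw]] := xright _ t0t tc'.
  exists w; split => //; first exact: le_trans (ltW cu).
    move=> s ts sw; rewrite (yDl t tc') (yl t (ltW tc')).
    by rewrite (yl s (le_trans sw wc)) xw.
  by move=> s ts sw; rewrite (yDl t tc') (yDl s (lt_le_trans sw wc)) xDw.
- move=> t t0t tu; have [tc'|ct] := leP t c.
    have [v [k [vt xv xDv xDt]]] := xleft _ t0t tc'.
    exists v, k; split => //.
    - move=> s vs st; rewrite (yl t tc') (yl s (ltW (lt_le_trans st tc'))).
      exact: xv.
    - by move=> s vs st; rewrite (yDl s (lt_le_trans st tc')) xDv.
    - move=> _; rewrite inE negb_or => /andP[tnc tP].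
      have tltc : t < c by rewrite lt_neqAle tnc.
      by rewrite yDl// xDt.
  exists c, m; split => //.
  - by move=> s cs st; rewrite !yr//; [ring | exact: ltW].
  - by move=> s cs st; rewrite yDr.
  - by move=> _ _; rewrite yDr// ltW.
- by rewrite inE Pt0 orbT.
Qed.

Arguments euler_polygon_extend {R T f t0 x0 M eps c u m x xD P}.

(** * Density from approximating points, and infima of closed sets *)

Lemma left_dense_adherent (R : realType) (J : set R) (c : R) :
  J c -> (forall e, 0 < e -> exists g, [/\ J g, c - e < g & g < c]) ->
  left_dense J c.
Proof.
move=> Jc adh; have [g [Jg _ gc]] := adh _ ltr01.
have ubc : ubound [set s | J s /\ s < c] c by move=> s [_ /ltW].
split => //.
  by apply: (le_lt_trans (y := g%:E));
    [apply: ereal_inf_lbound; exists g | rewrite lte_fin].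
rewrite /backward_jump; case: eqP => [E|_].
  have : [set s | J s /\ s < c] g by [].
  by rewrite E.
apply/eqP; rewrite eq_le; apply/andP; split; first by apply: ge_sup => //; exists g.
rewrite leNgt; apply/negP => sc.
have [k [Jk sk kc]] : exists k,
    [/\ J k, c - (c - sup [set s | J s /\ s < c]) < k & k < c].
  by apply: adh; rewrite subr_gt0.
have : k <= sup [set s | J s /\ s < c] by apply: ub_le_sup => //; exists c.
by lra.
Qed.

Lemma right_dense_adherent (R : realType) (J : set R) (c : R) :
  J c -> (forall e, 0 < e -> exists g, [/\ J g, c < g & g < c + e]) ->
  right_dense J c.
Proof.
move=> Jc adh; have [g [Jg cg _]] := adh _ ltr01.
have lbc : lbound [set s | J s /\ c < s] c by move=> s [_ /ltW].
split => //.
  by apply: (lt_le_trans (y := g%:E));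
    [rewrite lte_fin | apply: ereal_sup_ubound; exists g].
rewrite /forward_jump; case: eqP => [E|_].
  have : [set s | J s /\ c < s] g by [].
  by rewrite E.
apply/eqP; rewrite eq_le; apply/andP; split; last by apply: lb_le_inf => //; exists g.
rewrite leNgt; apply/negP => sc.
have [k [Jk sk kc]] : exists k,
    [/\ J k, c < k & k < c + (inf [set s | J s /\ c < s] - c)].
  by apply: adh; rewrite subr_gt0.
have : inf [set s | J s /\ c < s] <= k by apply: ge_inf => //; exists c.
by lra.
Qed.

Lemma closed_inf_mem (R : realType) (A : set R) :
  closed A -> has_inf A -> A (inf A).
Proof.
move=> clA infA; apply: clA => U /nbhs_ballP[e /= e0 eU].
have [g Ag ge] := inf_adherent e0 infA.
exists g; split => //; apply: eU; rewrite /ball/= distrC ger0_norm.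
  by rewrite ltrBlDl.
by rewrite subr_ge0; apply: ge_inf => //; case: infA.
Qed.

(** * Reaching the end of the interval *)

(** The polygon ends at the largest point of the interval, because [t0 + h] may lie outside [T]. *)
Lemma euler_polygon_exists (R : realType) (T : set R) (f : R -> R -> R)
    (t0 x0 a b h M eps : R) :
  closed T -> T t0 -> 0 < b -> 0 <= M -> 0 <= h -> h <= a -> M * h <= b ->
  rd_continuous2 (ts_interval T t0 a) (box T t0 x0 a b) f ->
  (forall t y, box T t0 x0 a b (t, y) -> `|f t y| <= M) -> 0 < eps ->
  exists c, [/\ ts_interval T t0 h c, forall t, ts_interval T t0 h t -> t <= c &
    exists x xD P, euler_polygon R T f t0 x0 M eps c x xD P].
Proof.
move=> clT Tt0 b0 M0 h0 ha Mhb rdf fM eps0.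
pose I := ts_interval T t0 h; pose J := ts_interval T t0 a.
have IE t : I t <-> [/\ T t, t0 <= t & t <= t0 + h].
  by rewrite /I /ts_interval /= in_itv/=; split=> [[? /andP[]]|[? -> ->]].
have IJ t : I t -> J t.
  move=> /IE[Tt t0t th]; split => //; rewrite /= in_itv/= t0t/=.
  by apply: (le_trans th); rewrite lerD2l.
pose poly c := exists x xD P, euler_polygon R T f t0 x0 M eps c x xD P.
pose G := [set c | I c /\ poly c].
have Gt0 : G t0.
  split; first by apply/IE; split; rewrite ?lexx ?lerDl.
  by exists (fun=> x0), (fun=> 0), [:: t0]; exact: euler_polygon_start.
have ubG : ubound G (t0 + h) by move=> c [/IE[]].
have G0 : G !=set0 by exists t0.
have hubG : has_ubound G by exists (t0 + h).
pose c := sup G.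
have leGc g : G g -> g <= c by move=> Gg; exact: ub_le_sup.
have Ic : I c.
  apply/IE; split; [|exact: leGc|exact: ge_sup].
  by apply: clT => U /(closure_sup G0 hubG)[g [[/IE[Tg _ _] _] Ug]]; exists g.
have approx (e : R) : 0 < e -> exists2 g, G g & c - e < g.
  by move=> e0; exact: sup_adherent.
clearbody c.
(* The Lipschitz bound up to [g] and the slope bound after it add up to [M * (t - t0)], at most
   [M * h]. The case [m = 0] places [x g] itself in the box. *)
have in_box g x xD P m t : euler_polygon R T f t0 x0 M eps g x xD P -> I g ->
    `|m| <= M -> I t -> g <= t -> `|x g + m * (t - g) - x0| <= b.
  move=> [xt0 xlip _ _ _ _] /IE[_ t0g _] mM /IE[_ _ th] gt.
  apply: le_trans Mhb; apply: (le_trans (y := M * (t - t0))); last first.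
    by rewrite ler_wpM2l// lerBlDl.
  have := xlip g t0; rewrite xt0 (ger0_norm (x := g - t0)) ?subr_ge0// => xg.
  have mt : `|m * (t - g)| <= M * (t - g).
    by rewrite normrM (ger0_norm (x := t - g)) ?subr_ge0// ler_wpM2r// subr_ge0.
  rewrite addrAC; apply: (le_trans (ler_normD _ _)).
  have -> : M * (t - t0) = M * (g - t0) + M * (t - g) by ring.
  exact: lerD.
have slopeM g x xD P : euler_polygon R T f t0 x0 M eps g x xD P -> I g ->
    `|f g (x g)| <= M.
  move=> pg Ig; apply: fM; split; first exact: IJ.
  have := in_box g x xD P 0 g pg Ig; rewrite normr0 mul0r addr0; exact.
have small (d m g t : R) : 0 < d -> `|m| <= M -> g <= t -> t - g < d / (M + 1) ->
    `|m * (t - g)| < d.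
  move=> d0 mM gt tgd; rewrite normrM (ger0_norm (x := t - g)) ?subr_ge0//.
  have M1 : 0 < M + 1 by lra.
  move: tgd; rewrite ltr_pdivlMr// => tgd.
  apply: le_lt_trans tgd; rewrite mulrC; apply: ler_wpM2l; first by rewrite subr_ge0.
  by lra.
(* If the supremum were not reached, it would be left-dense; a polygon ending at a close enough [g]
   could then be prolonged up to [c] with slope [f g (x g)]. *)
have [_ [x [xD [P pc]]]] : G c.
  apply: contrapT => nG.
  have adh (e : R) : 0 < e -> exists g, [/\ G g, c - e < g & g < c].
    move=> e0; have [g Gg cg] := approx e e0.
    exists g; split => //; rewrite lt_neqAle leGc// andbT.
    by apply/eqP => gc; apply: nG; rewrite -gc.
  have ldc : left_dense J c.
    apply: left_dense_adherent; first exact: IJ.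
    by move=> e /adh[g [[Ig _] ? ?]]; exists g; split => //; exact: IJ.
  have [d d0 Hd] := left_dense_uniform R T t0 x0 a b f b0 rdf c eps ldc eps0.
  (* The first bound on [q] keeps the times within [d] of [c], the second keeps the increment of the
     linear piece below [d]; [M + 1] avoids division by zero. *)
  have [q [q0 qd qr]] : exists q : R, [/\ 0 < q, q <= d & q <= d / (M + 1)].
    exists (Num.min d (d / (M + 1))).
    by rewrite lt_min d0 divr_gt0 ?ge_min ?lexx ?orbT//; lra.
  have [g [Gg cqg gc]] : exists g, [/\ G g, c - q < g & g < c].
    exact: adh.
  have [Ig [x [xD [P pg]]]] := Gg.
  have mM := slopeM _ _ _ _ pg Ig.
  apply: nG; split => //; case/IE: (Ig) => Tg t0g gh; case/IE: (Ic) => Tc t0c ch.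
  apply: (euler_polygon_extend pg t0g Tc gc mM) => t Tt gt tc.
  have It : I t by apply/IE; split => //; lra.
  apply: Hd => //; [exact: IJ| exact: IJ|lra|lra| | |].
  - have := in_box _ _ _ _ 0 g pg Ig; rewrite normr0 mul0r addr0; exact.
  - exact: in_box pg Ig mM It gt.
  - rewrite addrAC subrr add0r; apply: small => //.
    by apply: (lt_le_trans _ qr); lra.
exists c; split => //; last by exists x, xD, P.
move=> w Iw; rewrite leNgt; apply/negP => cw.
have mM := slopeM _ _ _ _ pc Ic.
case/IE: (Ic) => Tc t0c ch.
(* Any admissible prolongation past [c] inside [I] contradicts that [c] bounds the reachable
   endpoints. *)
have extend u : I u -> c < u ->
    (forall t, T t -> c <= t -> t < u -> 
      `|f c (x c) - f t (x c + f c (x c) * (t - c))| <= eps) -> False.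
  move=> Iu cu res; case/IE: (Iu) => Tu t0u uh.
  have : u <= c.
    apply: leGc; split => //; exact: (euler_polygon_extend pc t0c Tu cu mM res).
  by rewrite leNgt cu.
have res_c : `|f c (x c) - f c (x c + f c (x c) * (c - c))| <= eps.
  by rewrite subrr mulr0 addr0 subrr normr0 ltW.
have [adh|nadh] := pselect (forall e : R, 0 < e -> exists g, [/\ I g, c < g & g < c + e]).
  have rdc : right_dense J c.
    apply: right_dense_adherent; first exact: IJ.
    by move=> e /adh[g [Ig ? ?]]; exists g; split => //; exact: IJ.
  have xcb : `|x c - x0| <= b.
    by have := in_box _ _ _ _ 0 c pc Ic; rewrite normr0 mul0r addr0; exact.
  have [d d0 Hd] := right_dense_joint_limit R T t0 x0 a b f b0 rdf c (x c)
    eps rdc xcb eps0.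
  have [q [q0 qd qr]] : exists q : R, [/\ 0 < q, q <= d & q <= d / (M + 1)].
    exists (Num.min d (d / (M + 1))).
    by rewrite lt_min d0 divr_gt0 ?ge_min ?lexx ?orbT//; lra.
  have [g [Ig cg gr]] : exists g, [/\ I g, c < g & g < c + q].
    exact: adh.
  apply: (extend g Ig cg) => t Tt; rewrite le_eqVlt => /orP[/eqP <- //|ct] tg.
  have It : I t by case/IE: Ig => _ _ gh; apply/IE; split => //; lra.
  rewrite distrC; apply: Hd => //; [exact: IJ|lra| |].
  - rewrite addrAC subrr add0r; apply: small => //; first exact: ltW.
    by apply: (lt_le_trans _ qr); lra.
  - exact: in_box pc Ic mM It (ltW ct).
have [e e0 He] : exists2 e : R, 0 < e & forall g, I g -> c < g -> c + e <= g.
  apply: contrapT => ne; apply: nadh => e e0; apply: contrapT => ng.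
  apply: ne; exists e => // g Ig cg; rewrite leNgt; apply/negP => ge.
  by apply: ng; exists g.
(* Here [c] is followed by a gap of length at least [e]. The infimum of [W] belongs to [T] by
   closedness and is the next point of [I], so only the residual at [c] has to be checked. *)
pose W := T `&` [set u | c + e <= u].
have infW : has_inf W.
  by split; [exists w; split; [case/IE: Iw | exact: He] | exists (c + e) => u []].
have [TW cW] : W (inf W).
  by apply: closed_inf_mem => //; apply: closedI => //; exact: closed_ge.
have Ww : inf W <= w by apply: ge_inf; [case: infW | split; [case/IE: Iw | exact: He]].
have cW' : c < inf W by move: cW; rewrite /=; lra.
apply: (extend (inf W)) => //; first by case/IE: Iw => _ _ wh; apply/IE; split => //; lra.
move=> t Tt; rewrite le_eqVlt => /orP[/eqP <- //|ct] tW.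
have It : I t by case/IE: Iw => _ _ wh; apply/IE; split => //; lra.
have : inf W <= t by apply: ge_inf; [case: infW | split => //; exact: He].
by rewrite leNgt tW.
Qed.

(** * Forward jumps and delta derivatives of polygons *)

Section ForwardJump.
Variables (R : realType) (I : set R).

(** No point lies to the right, so the convention for the empty set applies. This later allows the
    endpoint into the exceptional set. *)
Lemma forward_jump_max (c : R) : I c -> (forall t, I t -> t <= c) ->
  forward_jump I c = c.
Proof.
move=> Ic cmax; rewrite /forward_jump; case: eqP => [_|/eqP/set0P[s [Is]]].
  apply/eqP; rewrite eq_le; apply/andP; split; first by apply: ge_sup => //; exists c.
  by apply: ub_le_sup => //; exists c.
by rewrite ltNge cmax.
Qed.

Lemma forward_jump_ge (t u : R) : I u -> t < u -> t <= forward_jump I t.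
Proof.
move=> Iu tu; rewrite /forward_jump; case: eqP => [E|_].
  have : [set s | I s /\ t < s] u by [].
  by rewrite E.
by apply: lb_le_inf; [exists u | move=> s [_ /ltW]].
Qed.

Lemma forward_jump_le (t u : R) : I u -> t < u -> forward_jump I t <= u.
Proof.
move=> Iu tu; rewrite /forward_jump; case: eqP => [E|_].
  have : [set s | I s /\ t < s] u by [].
  by rewrite E.
by apply: ge_inf => //; exists t => s [_ /ltW].
Qed.

End ForwardJump.

(** To the right of [t] the defect vanishes by linearity. To the left it vanishes too when [t] is no
    breakpoint; at a right-scattered [t] the positive jump absorbs it, whatever the left slope. *)
Lemma euler_polygon_delta_derivative (R : realType) (T I : set R)
    (f : R -> R -> R) (t0 x0 M eps c : R) (x xD : R -> R) (P : seq R) (t : R) :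
  euler_polygon R T f t0 x0 M eps c x xD P -> 0 <= M ->
  (forall s, I s <-> [/\ T s, t0 <= s & s <= c]) ->
  I t -> t < c -> (forward_jump I t = t -> t \notin P) ->
  delta_derivative I x t (xD t).
Proof.
move=> [xt0 xlip _ xright xleft Pt0] M0 IE /IE[Tt t0t _] tc tP e e0.
have [u [Tu tu uc xu xDu]] := xright t t0t tc.
have Iu : I u by apply/IE; split => //; lra.
have := forward_jump_ge R I t u Iu tu; have := forward_jump_le R I t u Iu tu.
have := tP; set sg := forward_jump I t => sgP sgu tsg.
have xsg : x sg = x t + xD t * (sg - t) by exact: xu.
have lin s : x s = x t + xD t * (s - t) ->
    `|x sg - x s - xD t * (sg - s)| <= e * `|sg - s|.
  move=> xs; rewrite xsg xs.
  have -> : x t + xD t * (sg - t) - (x t + xD t * (s - t)) - xD t * (sg - s) = 0.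
    by ring.
  by rewrite normr0 mulr_ge0// ltW.
have [st|st] := eqVneq sg t.
  have tnP := sgP st.
  (* [t0] is a breakpoint, so [t] differs from it and has a linear piece on its left. *)
  have t0t' : t0 < t.
    by rewrite lt_neqAle t0t andbT; apply/eqP => t0e; rewrite -t0e Pt0 in tnP.
  have [v [m [vt xv _ xDt]]] := xleft t t0t' (ltW tc).
  near=> s => Is; apply: lin; have [ts|st'] := leP t s.
    by apply: xu => //; near: s; exact: lt_le_nbhsl.
  rewrite xDt//; apply: xv => //; near: s; exact: lt_le_nbhsr.
have tsg' : t < sg by rewrite lt_neqAle eq_sym st.
have K0 : 0 < M + `|xD t| + 1 by have := normr_ge0 (xD t); lra.
(* By the Lipschitz bound the defect is at most [(M + |xD t|) * |t - s|]; this radius brings it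
   below [e * (sg - t)], and [s < t] gives [sg - t <= |sg - s|]. *)
pose r := e * (sg - t) / (M + `|xD t| + 1).
have r0 : 0 < r by rewrite divr_gt0// mulr_gt0// subr_gt0.
near=> s => Is; have [ts|st'] := leP t s.
  by apply: lin; apply: xu => //; near: s; exact: lt_le_nbhsl.
have sr : `|t - s| < r by near: s; exact: nbhsx_ballx.
move: sr; rewrite /r ltr_pdivlMr// => sr.
have -> : x sg - x s - xD t * (sg - s) = (x t - x s) - xD t * (t - s).
  by rewrite xsg; ring.
apply: (le_trans (ler_normB _ _)); rewrite normrM.
have le1 := xlip t s.
have le2 : e * (sg - t) <= e * `|sg - s|.
  by rewrite ler_pM2l// gtr0_norm; lra.
apply: le_trans le2; apply: le_trans (ltW sr).
have := normr_ge0 (t - s); move: le1; nra.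
Unshelve. all: by end_near. Qed.

Arguments euler_polygon_delta_derivative {R T I f t0 x0 M eps c x xD P t}.

(** * From the polygon to an approximate solution *)

Lemma lipschitz_continuous (R : realType) (M : R) (x : R -> R) : 0 <= M ->
  (forall u v, `|x u - x v| <= M * `|u - v|) -> continuous x.
Proof.
move=> M0 xlip t; apply/cvgrPdist_le => e e0.
have M1 : 0 < M + 1 by lra.
have /(nbhsx_ballx t) : 0 < e / (M + 1) by rewrite divr_gt0.
apply: filterS => s; rewrite /ball/= ltr_pdivlMr// => ts.
by apply: (le_trans (xlip _ _)); have := normr_ge0 (t - s); nra.
Qed.

Theorem theorem3p2 (R : realType) (T : set R) (t0 x0 a b M h : R)
    (f : R -> R -> R) :
  time_scale T -> T t0 -> 0 < a -> 0 < b ->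
  rd_continuous2 (ts_interval T t0 a) (box T t0 x0 a b) f ->
  is_max [set `|f p.1 p.2| | p in box T t0 x0 a b] M ->
  h = step_length a b M ->
  forall eps : R, 0 < eps ->
  exists x : R -> R,
    approximate_solution (ts_interval T t0 h) (box T t0 x0 a b) f eps x /\
    x t0 = x0.
Proof.
move=> [_ clT] Tt0 a0 b0 rdf [[p boxp pM] ubM] hE eps eps0.
have M0 : 0 <= M by rewrite -pM.
have fM t y : box T t0 x0 a b (t, y) -> `|f t y| <= M.
  by move=> By; apply: ubM; exists (t, y).
have [h0 ha Mhb] : [/\ 0 <= h, h <= a & M * h <= b].
  rewrite hE /step_length; have [->|Mn0] := eqVneq M 0.
    by rewrite mul0r lexx !ltW.
  have Mp : 0 < M by rewrite lt_neqAle eq_sym Mn0.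
  split; first by rewrite le_min (ltW a0) divr_ge0// ltW.
    by rewrite ge_min lexx.
  by rewrite mulrC -ler_pdivlMr// ge_min lexx orbT.
have [c [Ic cmax [x [xD [P pol]]]]] := euler_polygon_exists R T f t0 x0 a b h M eps
  clT Tt0 b0 M0 h0 ha Mhb rdf fM eps0.
pose I := ts_interval T t0 h.
have t0c : t0 <= c by case: Ic => _; rewrite /= in_itv/= => /andP[].
have ch : c <= t0 + h by case: Ic => _; rewrite /= in_itv/= => /andP[].
(* As [c] is the maximum, the interval can be cut at [c], where the polygon ends. *)
have IE t : I t <-> [/\ T t, t0 <= t & t <= c].
  split=> [It|[Tt t0t tc]].
    by case: (It) => Tt; rewrite /= in_itv/= => /andP[t0t _]; split => //; exact: cmax.
  by split => //; rewrite /= in_itv/= t0t (le_trans tc).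
have [xt0 xlip xres xright xleft Pt0] := pol.
exists x; split; last exact: xt0.
split.
- move=> t It; case/IE: (It) => Tt t0t tc; split => /=.
    by split => //; rewrite /= in_itv/= t0t; lra.
  rewrite -xt0; apply: (le_trans (xlip _ _)); apply: le_trans Mhb.
  by rewrite ger0_norm ?subr_ge0// ler_wpM2l//; lra.
- by apply: continuous_subspaceT; exact: (lipschitz_continuous R M x M0 xlip).
(* The endpoint [c] is added to the breakpoints because the polygon controls its slope only before
   [c]. *)
pose S := [set t | [/\ I t, forward_jump I t = t & t \in c :: P]].
(* At [t0] no point of [I] lies to the left, so the limit is vacuous and [0] serves; elsewhere [xD]
   is constant just before [t]. *)
have left_lim t : I t -> has_left_limit (I `\` S) xD t.
  move=> /IE[_ t0t tc]; move: t0t; rewrite le_eqVlt => /orP[/eqP <-|t0t].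
    exists 0; apply/cvgrPdist_lt => e e0; rewrite near_withinE.
    by near=> s => -[[/IE[_ t0s _] _]] /=; rewrite ltNge t0s.
  have [v [m [vt _ xDv _]]] := xleft t t0t tc.
  exists m; apply/cvgrPdist_lt => e e0; rewrite near_withinE.
  near=> s => -[_ /= st]; rewrite xDv ?subrr ?normr0//.
  by near: s; exact: lt_le_nbhsr.
have right_const t : I t -> t < c ->
    \forall s \near t, t <= s -> xD s = xD t.
  move=> /IE[_ t0t _] tc; have [u [_ tu _ _ xDu]] := xright t t0t tc.
  by near=> s => ts; apply: xDu => //; near: s; exact: lt_nbhsl.
have offS t : (I `\` S) t -> t < c.
  move=> [It nS]; rewrite lt_neqAle cmax// andbT; apply/eqP => tc; apply: nS.
  split => //; first by rewrite tc; exact: forward_jump_max.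
  by rewrite tc inE eqxx.
have notP t : (I `\` S) t -> forward_jump I t = t -> t \notin P.
  move=> [It nS] jt; apply/negP => tP; apply: nS; split => //.
  by rewrite inE tP orbT.
exists S, xD; split.
- by apply: (@sub_finite_set _ _ [set` c :: P]) => // t [].
- by move=> t [].
- move=> t It; apply: (euler_polygon_delta_derivative pol) => //.
  + by case: It.
  + exact: offS.
  + exact: notP.
- split; [split|].
  (* Off [S] a right-dense point is no breakpoint, so [xD] equals [xD t] on both sides of it. *)
  + move=> t [It _ jt] nS; have tc := offS t (conj It nS).
    have tP := notP t (conj It nS) jt.
    case/IE: (It) => _ t0t _.
    have t0t' : t0 < t.
      by rewrite lt_neqAle t0t andbT; apply/eqP => t0e; rewrite -t0e Pt0 in tP.
    have [v [m [vt _ xDv xDt]]] := xleft t t0t' (ltW tc).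
    apply/cvgrPdist_lt => e e0; rewrite near_withinE.
    have rc := right_const t It tc.
    near=> s => _; suff -> : xD s = xD t by rewrite subrr normr0.
    have [ts|st] := leP t s; first by move: ts; near: s.
    by rewrite xDt// xDv//; near: s; exact: lt_le_nbhsr.
  + by move=> t [It _ _] _; exact: left_lim.
  + move=> t [It _ _]; split=> [_|_]; first exact: left_lim.
    have [tc|ct] := ltP t c.
      exists (xD t); apply/cvgrPdist_lt => e e0; rewrite near_withinE.
      by apply: filterS (right_const t It tc) => s H [_ /= /ltW/H ->];
        rewrite subrr normr0.
    exists 0; apply/cvgrPdist_lt => e e0; rewrite near_withinE.
    by near=> s => -[[/IE[_ _ sc] _]] /=; rewrite ltNge (le_trans sc).
- move=> t It; apply: xres; last exact: offS.
  + by case: It => /IE[].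
  + by case: It => /IE[].
Unshelve. all: by end_near. Qed.
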